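(* There exists an absolute constant $C>0$ such that the following holds. Let $0<\varepsilon<1/4$ and let $t,n$ be positive integers with $n>\varepsilon^{-Ct}$. Then every red/blue colouring of the edges of the complete graph $K_n$ in which every vertex is incident to at least $n/4+\varepsilon n$ red edges and at least $n/4+\varepsilon n$ blue edges contains an induced copy of $K_{t,t}$ in some colour: there exist disjoint vertex sets $P,Q$ with $|P|=|Q|=t$ and a colour $c\in\{\text{red},\text{blue}\}$ such that every edge between $P$ and $Q$ has colour $c$ and every edge with both endpoints in $P$, or both endpoints in $Q$, has the other colour.
   Context: A 2-colouring of $K_n$ assigns each edge of the complete graph on $n$ vertices one of the colours red or blue. The red (resp. blue) degree of a vertex is the number of red (resp. blue) edges incident to it. *)

(* Defs.v *)
From mathcomp Require Import all_boot.

Set Implicit Arguments.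
Unset Strict Implicit.
Unset Printing Implicit Defensive.


(* Colours are booleans: [true] is red, [false] is blue, and [~~ c] is the colour
   other than [c]. The diagonal values [col u u] are junk: every definition
   below evaluates [col] only on pairs of distinct vertices. *)
Definition colour := bool.
Definition red : colour := true.
Definition blue : colour := false.

Definition edge_colouring (n : nat) (col : 'I_n -> 'I_n -> colour) : Prop :=
  forall u v : 'I_n, u != v -> col u v = col v u.

Definition colour_degree (n : nat) (col : 'I_n -> 'I_n -> colour) (c : colour)
    (u : 'I_n) : nat :=
  #|[set v : 'I_n | (v != u) && (col u v == c)]|.

Definition induced_Ktt (n : nat) (col : 'I_n -> 'I_n -> colour) (t : nat)
    (c : colour) (P Q : {set 'I_n}) : Prop :=
  [/\ [disjoint P & Q],
      #|P| = t /\ #|Q| = t,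
      (forall u v, u \in P -> v \in Q -> col u v = c),
      (forall u v, u \in P -> v \in P -> u != v -> col u v = ~~ c)
    & (forall u v, u \in Q -> v \in Q -> u != v -> col u v = ~~ c)].

(* Main.v *)
(* Suppose that no induced pattern exists. Dependent random choice turns a positive
   density of colour c between two sets, all of whose large subsets contain t-cliques of
   the other colour, into an induced K_{t,t} of colour c. Applied to a single set of size
   ε^{-O(t)}, it shows that the set contains a still large subset (a tile) without
   t-cliques of one of the colours c; by Ramsey's theorem, all large subsets of such a
   tile contain t-cliques of the other colour. So all but few vertices can be covered by
   disjoint tiles, and between two tiles that avoid the same colour c the density of c is
   below ε/2. Let B_c be the union of the tiles avoiding c. Almost all of the c-coloured
   edges at a vertex of B_c go to the other union, so counting these edges gives
   |B_red| |B_blue| >= (1/4 + ε/2 - o(1)) n^2, which is impossible. *)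

Require Import Defs.
From mathcomp Require Import all_boot.
From mathcomp Require Import zify.

Set Implicit Arguments.
Unset Strict Implicit.
Unset Printing Implicit Defensive.

(** * Cliques and common neighbourhoods *)

Definition common_nbrs (V : finType) (e : rel V) (B T : {set V}) : {set V} :=
  [set b in B | [forall a in T, e a b]].

Definition edge_count (V : finType) (e : rel V) (A B : {set V}) : nat :=
  \sum_(a in A) \sum_(b in B) e a b.

Definition clique (V : finType) (e : rel V) (S : {set V}) : bool :=
  [forall u in S, forall v in S, (u != v) ==> e u v].

Definition has_clique (V : finType) (e : rel V) (t : nat) (A : {set V}) : bool :=
  [exists S : {set V}, [&& S \subset A, #|S| == t & clique e S]].

Definition clique_rich (V : finType) (e : rel V) (t M : nat) (A : {set V}) : Prop :=
  forall W : {set V}, W \subset A -> M <= #|W| -> has_clique e t W.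

Lemma cliqueP (V : finType) (e : rel V) (S : {set V}) :
  reflect {in S &, forall u v, u != v -> e u v} (clique e S).
Proof.
apply: (iffP forall_inP) => [cS u v uS vS uv | cS u uS].
  exact: (implyP (forall_inP (cS u uS) v vS)).
by apply/forall_inP => v vS; apply/implyP; exact: cS.
Qed.

Lemma has_cliqueP (V : finType) (e : rel V) (t : nat) (A : {set V}) :
  reflect (exists S : {set V}, [/\ S \subset A, #|S| = t & clique e S])
          (has_clique e t A).
Proof.
apply: (iffP existsP) => -[S].
  by case/and3P=> SA /eqP St cS; exists S.
by case=> SA /eqP St cS; exists S; rewrite SA St cS.
Qed.

Lemma has_clique_sub (V : finType) (e : rel V) (t : nat) (A B : {set V}) :
  A \subset B -> has_clique e t A -> has_clique e t B.
Proof.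
move=> AB /has_cliqueP[S [SA St cS]]; apply/has_cliqueP; exists S; split=> //.
exact: subset_trans AB.
Qed.

Lemma subset_of_card (V : finType) (A : {set V}) (m : nat) :
  m <= #|A| -> exists2 S : {set V}, S \subset A & #|S| = m.
Proof.
rewrite -bin_gt0 -cards_draws card_gt0 => /set0Pn[S].
by rewrite inE => /andP[SA /eqP Sm]; exists S.
Qed.

Lemma bin_leq_exp (n m : nat) : 'C(n, m) <= n ^ m.
Proof.
apply: (@leq_trans (n ^_ m)); first by rewrite -bin_ffact leq_pmulr ?fact_gt0.
elim: m => // m IHm; rewrite ffactnSr expnSr leq_mul ?leq_subr //.
Qed.

(** * Ramsey's theorem *)

Lemma clique_setU1 (V : finType) (e : rel V) (x : V) (S : {set V}) :
  symmetric e -> {in S, forall y, e x y} -> clique e S -> clique e (x |: S).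
Proof.
move=> sym_e xS /cliqueP cS; apply/cliqueP => u v.
rewrite !in_setU1 => /predU1P[->|uS] /predU1P[->|vS]; rewrite ?eqxx //.
- by move=> _; exact: xS.
- by rewrite sym_e => _; exact: xS.
- exact: cS.
Qed.

(** Outside a chosen vertex [x] of [A], every vertex is an [e]- or [f]-neighbour of [x], so one
    neighbourhood keeps half of the required size. A clique found there is extended by [x] or is
    already the other one. *)
Lemma ramsey (V : finType) (e f : rel V) (a b : nat) (A : {set V}) :
  symmetric e -> symmetric f -> (forall u v, u != v -> e u v || f u v) ->
  2 ^ (a + b) <= #|A| -> has_clique e a A \/ has_clique f b A.
Proof.
move=> sym_e sym_f ef.
have triv (g : rel V) (W : {set V}) : has_clique g 0 W.
  apply/has_cliqueP; exists set0; rewrite sub0set cards0; split=> //.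
  by apply/cliqueP => u v; rewrite inE.
have grow (g : rel V) x (W : {set V}) m : symmetric g -> x \in W ->
    has_clique g m [set y in W :\ x | g x y] -> has_clique g m.+1 W.
  move=> sym_g xW /has_cliqueP[S [/subsetP SW Sm cS]].
  apply/has_cliqueP; exists (x |: S); split.
  - apply/subsetP => y; rewrite in_setU1 => /predU1P[-> //|/SW].
    by rewrite !inE => /andP[/andP[]].
  - rewrite cardsU1 Sm; case: (boolP (x \in S)) => // /SW.
    by rewrite !inE eqxx.
  - by apply: clique_setU1 => // y /SW; rewrite inE => /andP[].
elim: a b A => [|a IHa] b A; first by left; exact: triv.
elim: b A => [|b IHb] A; first by right; exact: triv.
move=> cA.
have [x xA] : exists x, x \in A.
  by apply/set0Pn; rewrite -card_gt0 (leq_trans _ cA) ?expn_gt0.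
set N := fun g : rel V => [set y in A :\ x | g x y].
have cN : #|A| <= (#|N e| + #|N f|).+1.
  rewrite (cardsD1 x A) xA ltnS (leq_trans _ (leq_card_setU _ _)) //.
  apply/subset_leq_card/subsetP => y yA; rewrite !inE.
  move: (yA); rewrite !inE => /andP[yx ->]; rewrite yx /=.
  by apply: ef; rewrite eq_sym.
have [Ne|Ne] := leqP (2 ^ (a + b.+1)) #|N e|.
  have [He|Hf] := IHa _ _ Ne; first by left; exact: grow He.
  right; apply: has_clique_sub Hf; apply/subsetP => y.
  by rewrite !inE => /andP[/andP[]].
have Nf : 2 ^ (a.+1 + b) <= #|N f|.
  move: cA Ne; rewrite addSn addnS !expnS; lia.
have [He|Hf] := IHb _ Nf; last by right; exact: grow Hf.
left; apply: has_clique_sub He; apply/subsetP => y.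
by rewrite !inE => /andP[/andP[]].
Qed.

(** * Dependent random choice *)

Lemma card_filter_sum (V : finType) (p : pred V) (B : {set V}) :
  \sum_(b in B) p b = #|[set b in B | p b]|.
Proof.
rewrite -sum1_card big_mkcond [RHS]big_mkcond /=; apply: eq_bigr => b _.
by rewrite inE; case: (b \in B); case: (p b).
Qed.

(* At least a [1 / 2k] fraction of the vertices of [A] has degree [#|B| / 2k]. *)
Lemma power_sum_degrees (V : finType) (e : rel V) (A B : {set V}) (k r : nat) :
  0 < #|B| -> #|A| * #|B| <= k * edge_count e A B ->
  #|A| * #|B| ^ r <=
    (2 * k) ^ r.+1 * \sum_(a in A) #|[set b in B | e a b]| ^ r.
Proof.
move=> B0 dens; set d := fun a => #|[set b in B | e a b]|.
pose H := [set a in A | #|B| <= 2 * k * d a].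
have cH : #|A| <= 2 * k * #|H|.
  rewrite -(leq_pmul2r B0).
  (* Vertices outside [H] have degree below [#|B| / 2k], so they carry at most half of the
     guaranteed [#|A| * #|B| / k] edges. *)
  suff : \sum_(a in A) 2 * k * d a <= 2 * k * #|H| * #|B| + #|A| * #|B|.
    rewrite -big_distrr /= -(eq_bigr _ (fun a _ => card_filter_sum (e a) B)).
    rewrite -/(edge_count e A B); lia.
  rewrite -[#|A| * _]sum_nat_const mulnAC [_ * #|H|]mulnC -card_filter_sum big_distrl /=.
  rewrite -big_split leq_sum //= => a aA.
  have da : d a <= #|B| by apply/subset_leq_card/subsetP => b; rewrite inE => /andP[].
  case: (leqP #|B| (2 * k * d a)) => [_|/ltnW h] /=; last by rewrite mul0n.
  rewrite mul1n.
  by rewrite (leq_trans _ (leq_addr _ _)) // leq_mul2l da orbT.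
apply: (@leq_trans (2 * k * #|H| * #|B| ^ r)); first by rewrite leq_mul2r cH orbT.
rewrite expnS -!mulnA leq_mul2l /= leq_mul2l; apply/orP; right.
rewrite big_distrr /= -sum_nat_const.
rewrite [leqRHS](bigID (mem H)) /= (leq_trans _ (leq_addr _ _)) //.
rewrite big_mkcond [leqRHS]big_mkcond leq_sum //= => a _.
rewrite inE; case: (a \in A) => //=; case: (leqP #|B| (2 * k * d a)) => // ha.
by rewrite -expnMn; case: (r) => [|q] //; rewrite leq_exp2r.
Qed.

(* Dependent random choice, by counting the pairs [(X, a)] where [X] is an [r]-tuple
   of vertices of [B] in the neighbourhood of [a]: an [X] with at least [M] common
   neighbours in [A] yields a clique [T] such that [X] lies in the common
   neighbourhood of [T]. *)
Lemma rich_common_nbrs (V : finType) (e f : rel V) (A B : {set V})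
    (k r t M : nat) :
  0 < #|B| -> #|A| * #|B| <= k * edge_count e A B -> clique_rich f t M A ->
  (2 * k) ^ r.+1 * (M * #|B| ^ r + #|A| ^ t.+1 * M ^ r) < #|A| * #|B| ^ r ->
  exists T : {set V}, [/\ T \subset A, #|T| = t, clique f T
    & M <= #|common_nbrs e B T|].
Proof.
move=> B0 dens rich num.
pose fam := [set T : {set V} | [&& T \subset A, #|T| == t & clique f T]].
case: (boolP [exists T in fam, M <= #|common_nbrs e B T|]).
  by case/exists_inP=> T; rewrite inE => /and3P[TA /eqP Tt cT] MT; exists T.
move=> none; exfalso; move: num; apply/negP; rewrite -leqNgt.
apply: leq_trans (power_sum_degrees r B0 dens) _; rewrite leq_mul2l.
apply/orP; right.
pose F := ffun_on (mem B) : {pred {ffun 'I_r -> V}}.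
pose N (X : {ffun 'I_r -> V}) := [set a in A | [forall i, e a (X i)]].
have -> : \sum_(a in A) #|[set b in B | e a b]| ^ r = \sum_(X in F) #|N X|.
  rewrite [RHS](eq_bigr (fun X : {ffun _ -> _} => \sum_(a in A) [forall i, e a (X i)] : nat)); last first.
    by move=> X _; rewrite card_filter_sum.
  rewrite exchange_big; apply: eq_bigr => a _ /=.
  rewrite -{1}(card_ord r) -card_ffun_on -sum1_card big_mkcond [RHS]big_mkcond /=.
  apply: eq_bigr => X _; rewrite /F.
  have -> : (X \in ffun_on [set b in B | e a b]) =
      (X \in ffun_on (mem B)) && [forall i, e a (X i)].
    apply/ffun_onP/andP => [h | [/ffun_onP h /forallP g] i].
      split; first by apply/ffun_onP => i; case/setIdP: (h i).
      by apply/forallP => i; case/setIdP: (h i).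
    by rewrite inE g andbT; exact: h.
  by case: (X \in _) => //; case: forallP.
(* A tuple with fewer than [M] common neighbours adds at most [M]; any other adds at most [#|A|]
   and, by richness, lies in the common neighbourhood of some [T]. *)
apply: (@leq_trans (\sum_(X in F)
    (M + #|A| * \sum_(T in fam) (X \in ffun_on (mem (common_nbrs e B T)))))).
  apply: leq_sum => X /ffun_onP XF.
  have NA : N X \subset A by apply/subsetP => a; rewrite inE => /andP[].
  have [/(rich _ NA)/has_cliqueP[T [TN Tt cT]]|/ltnW NM] := leqP M #|N X|; last first.
    exact: leq_trans (leq_addr _ _).
  have TF : T \in fam by rewrite inE Tt cT eqxx (subset_trans TN NA).
  rewrite (bigD1 T) //= mulnDr.
  have -> : X \in ffun_on (mem (common_nbrs e B T)).
    apply/ffun_onP => i; rewrite inE; apply/andP; split; first exact: XF.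
    apply/forall_inP => a /(subsetP TN); rewrite inE => /andP[_ /forallP]; exact.
  by move: (subset_leq_card NA); lia.
rewrite big_split /= sum_nat_const card_ffun_on card_ord mulnC leq_add2l.
rewrite -big_distrr /= expnS -mulnA leq_mul2l; apply/orP; right.
rewrite exchange_big /=.
(* Each [T] captures at most [M ^ r] tuples by [none], and there are at most [#|A| ^ t] sets [T],
   whence the exponent [t.+1]. *)
apply: (@leq_trans (\sum_(T in fam) M ^ r)).
  apply: leq_sum => T TF.
  have hT : #|common_nbrs e B T| <= M.
    by rewrite ltnW // ltnNge; apply: contra none => h; apply/exists_inP; exists T.
  apply: (@leq_trans (#|common_nbrs e B T| ^ r)); last first.
    by case: (r) => [|q] //; rewrite leq_exp2r.
  rewrite -[leqRHS](congr1 _ (card_ord r)) -card_ffun_on -sum1_card.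
  rewrite big_mkcond [leqRHS]big_mkcond /=.
  by apply: leq_sum => X _; case: (X \in F); case: (X \in _).
rewrite sum_nat_const leq_mul2r; apply/orP; right.
apply: leq_trans (bin_leq_exp _ _); rewrite -cards_draws.
apply/subset_leq_card/subsetP => T.
by rewrite !inE => /and3P[-> ->].
Qed.

(** Tuples of length [r = 2 * t], with all sizes powers of [2 * k]: by [4 + 2 * i <= j], each of the
    two terms on the left of the numerical condition, even with an extra factor [2 * k], is at most
    the right side, and [2 < 2 * k] makes the sum strict. *)
Lemma rich_common_nbrs_exp (V : finType) (e f : rel V) (A B : {set V})
    (k t i j : nat) :
  1 < k -> 0 < t -> 4 + 2 * i <= j ->
  #|A| = (2 * k) ^ (j * t) -> #|B| = (2 * k) ^ (j * t) ->
  #|A| * #|B| <= k * edge_count e A B ->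
  clique_rich f t ((2 * k) ^ (i * t)) A ->
  exists T : {set V}, [/\ T \subset A, #|T| = t, clique f T
    & (2 * k) ^ (i * t) <= #|common_nbrs e B T|].
Proof.
move=> k1 t0 ij cA cB dens rich.
have K0 : 0 < 2 * k by lia.
apply: (rich_common_nbrs (r := 2 * t) _ dens rich); first by rewrite cB expn_gt0 K0.
rewrite cA cB; set K := 2 * k in K0 *.
have K3 : 2 < K by rewrite /K; lia.
rewrite -(ltn_pmul2l K0) mulnA -expnS mulnDr.
rewrite -!expnM -!expnD -expnS.
apply: (@leq_ltn_trans (2 * K ^ (j * t + j * t * (2 * t)))).
  have K1 : 1 < K by exact: ltnW.
  by rewrite [leqRHS]mul2n -addnn leq_add // leq_exp2l //; nia.
by rewrite expnS ltn_pmul2r ?expn_gt0 ?K0.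
Qed.

(** * Induced patterns from dense rich pairs *)

Definition adj (n : nat) (col : 'I_n -> 'I_n -> colour) (c : colour) : rel 'I_n :=
  [rel u v | (u != v) && (col u v == c)].

Lemma adj_sym (n : nat) (col : 'I_n -> 'I_n -> colour) (c : colour) :
  edge_colouring col -> symmetric (adj col c).
Proof. by move=> sym u v; rewrite /adj /= eq_sym; case: eqVneq => //= /sym->. Qed.

(** Dependent random choice in [A] gives [P]; richness of [B] gives [Q] among the common neighbours
    of [P]. The sets [A] and [B] may coincide: [adj] is irreflexive, so [P] and [Q] are disjoint
    anyway. *)
Lemma rich_pair_induced_Ktt (n : nat) (col : 'I_n -> 'I_n -> colour) (c : colour)
    (k t i j : nat) (A B : {set 'I_n}) :
  edge_colouring col -> 1 < k -> 0 < t -> 4 + 2 * i <= j ->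
  #|A| = (2 * k) ^ (j * t) -> #|B| = (2 * k) ^ (j * t) ->
  #|A| * #|B| <= k * edge_count (adj col c) A B ->
  clique_rich (adj col (~~ c)) t ((2 * k) ^ (i * t)) A ->
  clique_rich (adj col (~~ c)) t ((2 * k) ^ (i * t)) B ->
  exists P Q : {set 'I_n}, induced_Ktt col t c P Q.
Proof.
move=> sym k1 t0 ij cA cB dens richA richB.
have [P [PA Pt /cliqueP cP hP]] := rich_common_nbrs_exp k1 t0 ij cA cB dens richA.
have NB : common_nbrs (adj col c) B P \subset B.
  by apply/subsetP => b; rewrite inE => /andP[].
have /has_cliqueP[Q [/subsetP QN Qt /cliqueP cQ]] := richB _ NB hP.
have PQ u v : u \in P -> v \in Q -> adj col c u v.
  by move=> uP /QN; rewrite inE => /andP[_ /forall_inP]; exact.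
exists P, Q; split=> //.
- apply/pred0P => u /=; apply/negP => /andP[uP uQ].
  by have := PQ _ _ uP uQ; rewrite /adj /= eqxx.
- by move=> u v uP vQ; have /andP[_ /eqP] := PQ _ _ uP vQ.
- by move=> u v uP vP uv; have /andP[_ /eqP] := cP _ _ uP vP uv.
- by move=> u v uQ vQ uv; have /andP[_ /eqP] := cQ _ _ uQ vQ uv.
Qed.

(** * Clique-free tiles and the tiling *)

Definition clique_free_tile (n : nat) (col : 'I_n -> 'I_n -> colour) (c : colour)
    (t m : nat) (S : {set 'I_n}) : bool :=
  (#|S| == m) && ~~ has_clique (adj col c) t S.

Lemma edge_countC_leq (n : nat) (col : 'I_n -> 'I_n -> colour) (c : colour)
    (A B : {set 'I_n}) :
  edge_count (adj col c) A B + edge_count (adj col (~~ c)) A B <= #|A| * #|B|.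
Proof.
rewrite /edge_count -big_split -sum_nat_const leq_sum //= => a _.
rewrite -big_split -sum1_card leq_sum //= => b _.
by rewrite /adj /=; case: eqVneq; case: c; case: (col a b).
Qed.

(** The extra [#|A|] pays for the diagonal pairs, which [adj] never counts. *)
Lemma edge_countC_geq (n : nat) (col : 'I_n -> 'I_n -> colour) (c : colour)
    (A B : {set 'I_n}) :
  #|A| * #|B| <=
  edge_count (adj col c) A B + edge_count (adj col (~~ c)) A B + #|A|.
Proof.
rewrite /edge_count -big_split -sum_nat_const -[X in _ + X]sum1_card -big_split.
rewrite leq_sum //= => a _.
apply: (@leq_trans (\sum_(b in B) (adj col c a b + adj col (~~ c) a b + (b == a)))).
  rewrite -sum1_card leq_sum // => b _.
  by rewrite /adj /= eq_sym; case: eqVneq; case: c; case: (col a b).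
rewrite !big_split /= leq_add2l card_filter_sum.
by rewrite -(cards1 a); apply/subset_leq_card/subsetP => b; rewrite !inE => /andP[].
Qed.

Lemma edge_count_symm (V : finType) (e : rel V) (A B : {set V}) :
  symmetric e -> edge_count e A B = edge_count e B A.
Proof.
move=> sym_e; rewrite /edge_count exchange_big.
by apply: eq_bigr => b _; apply: eq_bigr => a _; rewrite sym_e.
Qed.

Lemma sum_setU (V : finType) (A B : {set V}) (F : V -> nat) :
  [disjoint A & B] ->
  \sum_(i in A :|: B) F i = \sum_(i in A) F i + \sum_(i in B) F i.
Proof. by move=> AB; rewrite -bigU //; apply: eq_bigl => i; rewrite !inE. Qed.

Lemma edge_countUl (V : finType) (e : rel V) (A B C : {set V}) :
  [disjoint A & B] -> edge_count e (A :|: B) C = edge_count e A C + edge_count e B C.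
Proof. by move=> AB; rewrite /edge_count (sum_setU _ AB). Qed.

Lemma edge_countUr (V : finType) (e : rel V) (A B C : {set V}) :
  [disjoint A & B] -> edge_count e C (A :|: B) = edge_count e C A + edge_count e C B.
Proof.
move=> AB; rewrite /edge_count -big_split; apply: eq_bigr => a _ /=.
by rewrite (sum_setU _ AB).
Qed.

(* If all subsets of [W] of the smaller size contained cliques of both colours, then
   the majority colour in [W] would give an induced pattern. *)
Lemma clique_free_tile_exists (n : nat) (col : 'I_n -> 'I_n -> colour)
    (k t i j : nat) (W : {set 'I_n}) :
  edge_colouring col -> 3 < k -> 0 < t -> 4 + 2 * i <= j ->
  (forall P Q c, ~ induced_Ktt col t c P Q) -> (2 * k) ^ (j * t) <= #|W| ->
  exists (c : colour) (S : {set 'I_n}),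
    S \subset W /\ clique_free_tile col c t ((2 * k) ^ (i * t)) S.
Proof.
move=> sym k3 t0 ij noP cW.
have [W' W'W cW'] := subset_of_card cW.
pose Q c := [exists S : {set 'I_n},
  (S \subset W) && clique_free_tile col c t ((2 * k) ^ (i * t)) S].
case: (boolP (Q red || Q blue)).
  by case/orP=> /existsP[S /andP[? ?]]; [exists red | exists blue]; exists S.
move/negP=> noQ.
have rich c : clique_rich (adj col c) t ((2 * k) ^ (i * t)) W'.
  move=> X XW' cX; have [S SX cS] := subset_of_card cX.
  apply: (has_clique_sub SX); apply: contraT => noS.
  have Qc : Q c.
    apply/existsP; exists S; rewrite /clique_free_tile cS eqxx noS !andbT.
    exact: subset_trans (subset_trans SX XW') W'W.
  by case: noQ; apply/orP; case: c Qc {noS}; [left | right].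
have dense c : #|W'| * #|W'| <= k * edge_count (adj col c) W' W' -> False.
  move=> dens; have k1 : 1 < k by lia.
  have [P [R]] := rich_pair_induced_Ktt sym k1 t0 ij cW' cW' dens (rich _) (rich _).
  exact: noP.
(* If both densities are below [1 / k], counting pairs forces [(k - 2) * #|W'| < k], which fails for
   [k >= 4] and [#|W'| >= 2]. *)
have w2 : 1 < #|W'|.
  have jt : 0 < j * t by rewrite muln_gt0 t0 andbT; move: ij; clear; lia.
  by rewrite cW' (leq_ltn_trans jt) // ltn_expl //; move: k3; clear; lia.
have := edge_countC_geq col red W' W'; rewrite -[~~ red]/blue.
have /negP := @dense red; have /negP := @dense blue; rewrite -!ltnNge.
move: (edge_count _ _ _) (edge_count _ _ _) k3 w2 => x y; clear; nia.
Qed.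

Lemma free_tile_rich (n : nat) (col : 'I_n -> 'I_n -> colour) (c : colour)
    (t m M : nat) (S : {set 'I_n}) :
  edge_colouring col -> 4 ^ t <= M -> clique_free_tile col c t m S ->
  clique_rich (adj col (~~ c)) t M S.
Proof.
move=> sym tM /andP[_ free] W WS MW.
have tW : 2 ^ (t + t) <= #|W| by rewrite addnn -mul2n expnM (leq_trans tM).
have cov u v : u != v -> adj col c u v || adj col (~~ c) u v.
  by move=> uv; rewrite /adj /= uv; case: c {free}; case: (col u v).
have [H|//] := ramsey (adj_sym c sym) (adj_sym (~~ c) sym) cov tW.
by rewrite (has_clique_sub WS H) in free.
Qed.

(** A greater density would make the tiles a dense rich pair with [i = 1] and [j = 4 + 2 * 1], as
    [4 ^ t <= (2 * k) ^ t]. The case [A = B] bounds the edges inside one tile. *)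
Lemma free_tiles_sparse (n : nat) (col : 'I_n -> 'I_n -> colour) (c : colour)
    (k t : nat) (A B : {set 'I_n}) :
  edge_colouring col -> 1 < k -> 0 < t ->
  (forall P Q c, ~ induced_Ktt col t c P Q) ->
  clique_free_tile col c t ((2 * k) ^ (6 * t)) A ->
  clique_free_tile col c t ((2 * k) ^ (6 * t)) B ->
  k * edge_count (adj col c) A B <= #|A| * #|B|.
Proof.
move=> sym k1 t0 noP tA tB; rewrite leqNgt; apply/negP => /ltnW dens.
have tM : 4 ^ t <= (2 * k) ^ (1 * t) by rewrite mul1n leq_exp2r //; move: k1; clear; lia.
have [/andP[/eqP cA _] /andP[/eqP cB _]] := (tA, tB).
have [//|P [Q]] := rich_pair_induced_Ktt (i := 1) (j := 6) sym k1 t0 _ cA cB dens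
  (free_tile_rich sym tM tA) (free_tile_rich sym tM tB).
exact: noP.
Qed.

(** Greedy: split off a tile, recurse on the rest, and add the tile to the union of its colour. The
    clause on arbitrary tiles [S] carries the induction, since the tile added next is not one of
    those in the union. The exponent is [16 = 4 + 2 * 6] for tiles of exponent [6]. *)
Lemma free_tiling (n : nat) (col : 'I_n -> 'I_n -> colour) (k t : nat)
    (W : {set 'I_n}) :
  edge_colouring col -> 3 < k -> 0 < t ->
  (forall P Q c, ~ induced_Ktt col t c P Q) ->
  exists B : colour -> {set 'I_n},
    [/\ [disjoint B red & B blue], forall c, B c \subset W,
        #|W| < (2 * k) ^ (16 * t) + #|B red| + #|B blue|,
        (forall c S, clique_free_tile col c t ((2 * k) ^ (6 * t)) S ->
          k * edge_count (adj col c) S (B c) <= #|S| * #|B c|)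
      & forall c, k * edge_count (adj col c) (B c) (B c) <= #|B c| * #|B c|].
Proof.
move=> sym k3 t0 noP; have [N] := ubnP #|W|; elim: N W => // N IHN W WN.
have [small|big] := ltnP #|W| ((2 * k) ^ (16 * t)).
  exists (fun=> set0); rewrite -setI_eq0 setI0 eqxx !cards0 !addn0; split=> //.
  - by move=> c; exact: sub0set.
  - by move=> c S _; rewrite /edge_count big1 ?muln0 // => a _; rewrite big_set0.
  - by move=> c; rewrite /edge_count big_set0 muln0.
have [c0 [S [SW tS]]] := clique_free_tile_exists (i := 6) (j := 16) sym k3 t0 isT noP big.
have cS : #|S| = (2 * k) ^ (6 * t) by case/andP: tS => /eqP.
have S0 : 0 < #|S| by rewrite cS expn_gt0; move: k3; clear; lia.
have cWS := cardsID S W; rewrite (setIidPr SW) in cWS.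
have [|B [disB BW cB B1 B2]] := IHN (W :\: S).
  by move: WN S0 cWS; clear; lia.
have BS c : [disjoint S & B c].
  rewrite -setI_eq0 -subset0; apply/subsetP => x /setIP[xS /(subsetP (BW c))].
  by rewrite !inE xS.
have k1 : 1 < k by apply: leq_trans k3.
have cU c : #|S :|: B c| = #|S| + #|B c|.
  by apply/eqP; rewrite (leq_card_setU _ _).2.
exists (fun c => if c == c0 then S :|: B c else B c); split.
- have key c : [disjoint S :|: B c & B (~~ c)].
    rewrite -setI_eq0 setIUl setU_eq0 !setI_eq0 BS /=.
    by case: c; [exact: disB | rewrite disjoint_sym; exact: disB].
  by case: c0 {tS} => /=; [exact: (key red) | rewrite disjoint_sym; exact: (key blue)].
- move=> c; have BcW := subset_trans (BW c) (subsetDl _ _).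
  by case: ifP => _ //; rewrite subUset SW.
- by move: cB cWS; rewrite /red /blue; case: c0 {tS} => /=; rewrite cU /=; clear; lia.
- move=> c S' tS'; case: eqP => [cc0|_]; last exact: B1.
  rewrite -cc0 in tS; rewrite edge_countUr // cU !mulnDr leq_add ?B1 //.
  exact: free_tiles_sparse noP _ _.
- move=> c; case: eqP => [cc0|_]; last exact: B2.
  rewrite -cc0 in tS; rewrite cU.
  rewrite edge_countUl // !edge_countUr //.
  rewrite mulnDl !mulnDr !leq_add ?B2 ?(B1 _ _ tS) //; first exact: free_tiles_sparse noP _ _.
  by rewrite [leqRHS]mulnC edge_count_symm ?B1 //; exact: adj_sym.
Qed.

(** * Counting degrees *)

Lemma colour_degreeE (n : nat) (col : 'I_n -> 'I_n -> colour) (c : colour)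
    (u : 'I_n) : colour_degree col c u = \sum_v adj col c u v.
Proof.
rewrite /colour_degree -sum1_card big_mkcond; apply: eq_bigr => v _.
by rewrite inE /adj /= eq_sym; case: ifP.
Qed.

(* The degree condition is the one of [theorem1] with [eps] replaced by [2 / k]. *)
Lemma balanced_colouring_induced_Ktt (n : nat) (col : 'I_n -> 'I_n -> colour)
    (k t : nat) :
  edge_colouring col -> 3 < k -> 0 < t -> k * (2 * k) ^ (16 * t) < n ->
  (forall c u, (k + 8) * n <= 4 * k * colour_degree col c u) ->
  (forall P Q c, ~ induced_Ktt col t c P Q) -> False.
Proof.
move=> sym k3 t0 nbig deg noP.
have [B [disB _ cB _ B2]] := free_tiling setT sym k3 t0 noP.
set w := (2 * k) ^ (16 * t) in nbig cB; rewrite cardsT card_ord in cB.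
pose L := ~: (B red :|: B blue).
have cRB : #|B red :|: B blue| = #|B red| + #|B blue|.
  by apply/eqP; rewrite (leq_card_setU _ _).2.
have cL : #|B red| + #|B blue| + #|L| = n.
  by rewrite -cRB cardsC card_ord.
have degs c : (k + 8) * n * #|B c| <= 4 * k * (edge_count (adj col c) (B c) (B c) +
    edge_count (adj col c) (B c) (B (~~ c)) + #|B c| * #|L|).
  rewrite mulnC -sum_nat_const.
  apply: (@leq_trans (\sum_(u in B c) 4 * k * colour_degree col c u)).
    by apply: leq_sum.
  rewrite -big_distrr leq_mul2l /=; apply/orP; right.
  rewrite /edge_count -big_split -sum_nat_const -big_split leq_sum //= => u _.
  rewrite colour_degreeE (bigID (mem (B red :|: B blue))) /= leq_add //.
    by rewrite sum_setU //; case: c; rewrite // addnC.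
  rewrite -sum1_card big_mkcond [leqRHS]big_mkcond leq_sum //= => v _.
  by rewrite in_setC; case: (v \in _ :|: _) => //=; exact: leq_b1.
have dr := degs red; have db := degs blue.
have rr := B2 red; have bb := B2 blue.
have cross := edge_countC_leq col red (B red) (B blue).
(* Read from [B red], the blue cross edges share with the red ones the single bound
   [#|B red| * #|B blue|] of [cross]. *)
rewrite [edge_count _ _ (B (~~ blue))]edge_count_symm in db; last exact: adj_sym.
move: cL cB dr db rr bb cross nbig k3; rewrite -[~~ red]/blue -[~~ blue]/red.
move: #|B red| #|B blue| #|L| (edge_count _ (B red) (B red)).
move: (edge_count _ (B blue) (B blue)) (edge_count _ (B red) (B blue)).
move: (edge_count _ (B red) (B blue)) w; clear.
move=> eb w ebb er x y l err cL cB dr db rr bb cross nbig k3.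
have kw : w <= k * w by rewrite leq_pmull //; lia.
have z0 : 0 < x + y by lia.
have kl : k * l <= k * w by rewrite leq_mul2l; lia.
(* The three terms account for edges inside the unions, across them (by AM-GM), and to [L].
   Cancelling [x + y] gives [n <= k * l], against [k * l <= k * w < n]. *)
suff : (k + 8) * n * (x + y) <= (4 * n + k * n + 4 * (k * l)) * (x + y).
  by rewrite leq_pmul2r // mulnDl; lia.
have sum_n : x + y <= n by lia.
have zn : (x + y) * (x + y) <= n * (x + y) by rewrite leq_mul2r sum_n orbT.
have h1 : k * (4 * (x * y)) <= k * (n * (x + y)).
  by rewrite leq_mul2l (leq_trans _ zn) ?orbT // (leq_trans (nat_AGM2 _ _)).
have h2 : k * (eb + er) <= k * (x * y) by rewrite leq_mul2l cross orbT.
move: zn h1 h2 dr db rr bb; clear; rewrite !mulnDl !mulnDr !mulnA; lia.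
Qed.

(* Choice of parameters over the reals *)
From mathcomp Require Import all_order all_algebra.
From mathcomp Require Import all_classical all_reals all_analysis.
From mathcomp Require Import lra.

Import Order.TTheory GRing.Theory Num.Theory.
Local Open Scope ring_scope.

Theorem theorem1 (R : realType) :
  exists C : R, 0 < C /\
    forall (eps : R) (t n : nat),
      0 < eps -> eps < 1 / 4 ->
      (0 < t)%N -> (0 < n)%N ->
      n%:R > eps `^ (- (C * t%:R)) ->
      forall col : 'I_n -> 'I_n -> colour,
        edge_colouring col ->
        (forall u : 'I_n, n%:R / 4 + eps * n%:R <= (colour_degree col red u)%:R) ->
        (forall u : 'I_n, n%:R / 4 + eps * n%:R <= (colour_degree col blue u)%:R) ->
        exists (P Q : {set 'I_n}) (c : colour), induced_Ktt col t c P Q.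
Proof.
(* With [2 * k <= q ^ 3] shown below, [k * (2 * k) ^ (16 * t) <= (2 * k) ^ (17 * t) <= q ^ (51 *
   t)]. *)
exists 51%:R; split; first by rewrite ltr0n.
move=> eps t n eps0 eps4 t0 n0 nbig col sym degr degb.
apply: contrapT => none.
(* This [k] exceeds [2 / eps], so [eps] may be lowered to [2 / k], and
   [1 / 4 + 2 / k = (k + 8) / (4 * k)]. *)
pose q := eps^-1; pose k := (Num.trunc (2 * q)).+1.
have q0 : 0 < q by rewrite invr_gt0.
have q_eps : q * eps = 1 by rewrite mulVf // gt_eqF.
have q4 : 4 < q by nra.
have /andP[kl ku] : (k.-1%:R <= 2 * q < k%:R) by rewrite truncn_itv // mulr_ge0 // ltW.
have kq : (2 * k)%:R <= q ^+ 3.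
  have : (k%:R : R) <= 2 * q + 1 by rewrite /k -natr1 lerD2r.
  rewrite natrM !exprS expr0 mulr1; nra.
have k3 : (3 < k)%N by rewrite -(ltr_nat R); lra.
apply: (@balanced_colouring_induced_Ktt n col k t sym k3 t0); last first.
- by move=> P Q c PQ; apply: none; exists P, Q, c.
- move=> c u; have deg : n%:R / 4 + eps * n%:R <= (colour_degree col c u)%:R.
    by case: c.
  rewrite -(ler_nat R) !natrM natrD.
  have ke : 2 <= k%:R * eps by nra.
  have n0' : 0 <= n%:R :> R by [].
  nra.
- rewrite -(ltr_nat R); apply: (le_lt_trans _ nbig).
  rewrite powRN -natrM powR_mulrn ?(ltW eps0) // -exprVn -/q -[51%N]/(3 * 17)%N -mulnA exprM.
  apply: (@le_trans _ _ ((2 * k)%:R ^+ (17 * t))); last first.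
    by rewrite lerXn2r ?nnegrE // exprn_ge0 // ltW.
  rewrite -natrX ler_nat; apply: (@leq_trans ((2 * k) ^ (16 * t).+1)).
    by rewrite expnS leq_mul2r leq_pmull ?orbT.
  by rewrite leq_exp2l; lia.
Qed.
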